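(* Let $d\ge1$, let $\mathbb P$ be a probability law on $\mathbb R^d$, let $\mathbf X_1,\mathbf X_2,\dots$ be independent random vectors with law $\mathbb P$, and let $\mathbb P_n=\frac1n\sum_{i=1}^n\delta_{\{\mathbf X_i\}}$ be the empirical law. Then $$\sup_{\mathbf z\in\mathbb R^d,\ \delta\ge0}|D_\delta(\mathbf z|\mathbb P_n)-D_\delta(\mathbf z|\mathbb P)|\to0\quad\text{almost surely as }n\to\infty.$$
   Context: $\delta_{\{\mathbf x\}}$ is the Dirac mass at $\mathbf x$, $\|\cdot\|$ the Euclidean norm and $\langle\cdot,\cdot\rangle$ the Euclidean inner product. For laws $\mathbb Q,\mathbb Q'$ on $\mathbb R^d$ (no moment assumption) the Wasserstein distance is $d_W(\mathbb Q,\mathbb Q')=\inf_\Pi\int\|\mathbf x-\mathbf y\|\,\Pi(\mathrm d\mathbf x,\mathrm d\mathbf y)\in[0,\infty]$, over all joint laws $\Pi$ with marginals $\mathbb Q,\mathbb Q'$. For $\delta>0$ the robustified halfspace depth is $$D_\delta(\mathbf z|\mathbb Q)=\inf_{\mathbf u\in\mathbb R^d:\|\mathbf u\|=1}\ \sup_{\mathbb Q':d_W(\mathbb Q',\mathbb Q)\le\delta}\mathbb Q'(\{\mathbf x\in\mathbb R^d:\langle\mathbf u,\mathbf x-\mathbf z\rangle\ge0\}),$$ and $D_0(\mathbf z|\mathbb Q)=\inf_{\|\mathbf u\|=1}\mathbb Q(\{\mathbf x:\langle\mathbf u,\mathbf x-\mathbf z\rangle\ge0\})$ is the classical halfspace depth.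 *)

(* Defs.v *)
From HB Require Import structures.
From mathcomp Require Import all_boot all_order all_algebra.
From mathcomp Require Import all_classical all_reals all_analysis.

Set Implicit Arguments.
Unset Strict Implicit.
Unset Printing Implicit Defensive.

Import Order.TTheory GRing.Theory Num.Theory.
Import numFieldNormedType.Exports.

Local Open Scope classical_set_scope.
Local Open Scope ring_scope.

(** R^d is [d.-tuple R], for which the library provides the product sigma-algebra
    of the Borel sigma-algebras of the coordinates, i.e. the Borel sigma-algebra
    of R^d. *)

Section euclidean.
Context {R : realType} {d : nat}.
Implicit Types x y : d.-tuple R.

Definition vsub x y : d.-tuple R := [tuple tnth x i - tnth y i | i < d].

Definition inner x y : R := \sum_(i < d) tnth x i * tnth y i.

(** The norm that the library puts on vectors is the sup norm, hence this
    definition. *)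
Definition enorm x : R := Num.sqrt (inner x x).

Definition halfspace (u z : d.-tuple R) : set (d.-tuple R) :=
  [set x | 0 <= inner u (vsub x z)].

End euclidean.

Section wasserstein.
Context {R : realType} {d : nat}.
Local Open Scope ereal_scope.
Implicit Types Q : probability (d.-tuple R) R.

Definition coupling Q Q' (Pi : probability (d.-tuple R * d.-tuple R)%type R) :=
  (forall A, measurable A -> Pi (fst @^-1` A) = Q A) /\
  (forall A, measurable A -> Pi (snd @^-1` A) = Q' A).

Definition wasserstein Q Q' : \bar R :=
  ereal_inf [set \int[Pi]_(p in setT) (enorm (vsub p.1 p.2))%:E |
             Pi in coupling Q Q'].

End wasserstein.

Section depth.
Context {R : realType} {d : nat}.
Local Open Scope ereal_scope.
Implicit Types (z : d.-tuple R) (Q : probability (d.-tuple R) R).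

Definition halfspace_depth z Q : \bar R :=
  ereal_inf [set Q (halfspace u z) | u in [set u | enorm u = 1%R]].

(** Meaningful for [0 <= delta] only; the classical depth is taken as the
    definition at [delta = 0]. *)
Definition robust_depth (delta : R) z Q : \bar R :=
  if delta == 0%R then halfspace_depth z Q
  else ereal_inf [set
         ereal_sup [set (Q' : probability (d.-tuple R) R) (halfspace u z) |
                    Q' in [set Q' | wasserstein Q' Q <= delta%:E]] |
         u in [set u | enorm u = 1%R]].

End depth.

Section independence.
Context {dT dE : measure_display} {T : measurableType dT}
  {E : measurableType dE} {R : realType}.
Local Open Scope ereal_scope.

Definition mutually_independent (Pr : probability T R) (I : choiceType)
    (X : I -> {RV Pr >-> E}) : Prop :=
  forall (J : seq I) (A : I -> set E), uniq J ->
    (forall i, i \in J -> measurable (A i)) ->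
    Pr (\bigcap_(i in [set` J]) (X i @^-1` A i)) =
    \prod_(i <- J) Pr (X i @^-1` A i).

End independence.

Section empirical.
Context {dE : measure_display} {E : measurableType dE} {R : realType}.
Local Open Scope ereal_scope.

(** The empirical law of the [n.+1] points [x 0, ..., x n]; there is none for an
    empty sample. *)
Definition empirical (x : nat -> E) (n : nat) : set E -> \bar R :=
  mscale ((n.+1%:R^-1)%:nng)%R (msum (fun i => \d_(x i)) n.+1).

HB.instance Definition _ (x : nat -> E) (n : nat) :=
  Measure.on (empirical x n).

Let empirical_setT (x : nat -> E) (n : nat) : empirical x n [set: E] = 1.
Proof.
rewrite /empirical /mscale /= /msum.
rewrite (eq_bigr (fun=> 1%:E)); last by move=> i _; exact: diracT.
by rewrite sumEFin -EFinM sumr_const card_ord mulVf ?pnatr_eq0.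
Qed.

HB.instance Definition _ (x : nat -> E) (n : nat) :=
  Measure_isProbability.Build _ _ _ (empirical x n) (empirical_setT x n).

End empirical.

(* Main.v *)
From HB Require Import structures.
Require Import Defs.
From mathcomp Require Import all_boot all_order all_algebra.
From mathcomp Require Import all_classical all_reals all_analysis.
From mathcomp Require Import measurable_realfun ring lra zify.
Import Order.TTheory GRing.Theory Num.Theory.
Import numFieldNormedType.Exports.
Local Open Scope classical_set_scope.
Local Open Scope ring_scope.

(** Write [g x] for the distance of [x] to the halfspace [H].  Linear
    programming duality identifies the supremum of [Q'(H)] over the [Q'] at
    distance at most [delta > 0] from [Q] with the infimum over [lam >= 0] of
      lam * delta + E_Q (1 - lam * g)_+,
    an optimal [Q'] being obtained by projecting onto [H] the points closest to
    it until the budget [delta] is spent.  The superlevel sets of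
    (1 - lam * g)_+ are halfspaces, so that two laws which agree up to [eps] on
    all halfspaces have robust depths which agree up to [eps], uniformly in [z]
    and [delta].
    It remains to prove the Glivenko-Cantelli theorem for halfspaces.  For any
    law they have finitely many brackets of mass at most [eps]: by compactness
    of the set of directions this is a local matter, and near a given
    hyperplane the only obstruction is the mass that this hyperplane carries,
    on which one argues by induction on the dimension.  The strong law of large
    numbers is then applied to the ends of these brackets. *)

(** * Brackets for sets defined by linear inequalities *)

Section bracketing.
Context {dE : measure_display} {E : measurableType dE} {R : realType}.
Implicit Types (S H : set E) (s : seq (set E * set E)).

(** The coefficients form a row vector, so that the norm, the neighbourhoods and the compactness of
    the unit sphere of ['rV[R]_n] are at hand. *)
Definition lincomb {n} (f : 'I_n -> E -> R) (th : 'rV[R]_n) (x : E) : R :=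
  \sum_i th 0 i * f i x.

(** A pair is a lower and an upper end. Mass is counted inside [S] only, because the induction
    passes to the trace on a hyperplane. *)
Definition brackets (mu : set E -> \bar R) S (e : R) s :=
  forall p, p \in s -> [/\ measurable p.1, measurable p.2 &
    (mu (S `&` (p.2 `\` p.1)) <= e%:E)%E].

Definition bracketed S s H :=
  exists2 p, p \in s & S `&` p.1 `<=` H /\ S `&` H `<=` p.2.

Lemma measurable_lincomb {n} (f : 'I_n -> E -> R) th :
  (forall i, measurable_fun setT (f i)) -> measurable_fun setT (lincomb f th).
Proof.
move=> mf; apply: measurable_sum => i.
by apply: measurable_funM => //; exact: measurable_cst.
Qed.

Lemma measurable_ge0_set (g : E -> R) : measurable_fun setT g ->
  measurable [set x | 0 <= g x].
Proof.
move=> mg; rewrite (_ : [set _ | _] = setT `&` g @^-1` `[0, +oo[%classic).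
  by apply: mg => //; exact: measurable_itv.
by apply/seteqP; split => x /=; rewrite in_itv/= andbT // => -[].
Qed.

Lemma lincomb_near {n} (f : 'I_n -> E -> R) (t th : 'rV[R]_n) r x :
  (forall i, `|t 0 i - th 0 i| <= r) ->
  `|lincomb f t x - lincomb f th x| <= r * \sum_i `|f i x|.
Proof.
move=> h; rewrite /lincomb -sumrB mulr_sumr.
apply: le_trans (ler_norm_sum _ _ _) _; apply: ler_sum => i _.
by rewrite -mulrBl normrM ler_wpM2r.
Qed.

(* On the hyperplane [lincomb f th = 0] one of the functions is a combination
   of the others, which is what makes the induction on [n] possible. *)
Lemma lincomb_elim {n} (f : 'I_n.+1 -> E -> R) (t th : 'rV[R]_n.+1) j x :
  th 0 j != 0 -> lincomb f th x = 0 ->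
  lincomb f t x =
  lincomb (fun i => f (lift j i))
    (\row_i (t 0 (lift j i) - t 0 j / th 0 j * th 0 (lift j i))) x.
Proof.
move=> thj fx0.
have -> : lincomb f t x = lincomb f t x - t 0 j / th 0 j * lincomb f th x.
  by rewrite fx0 mulr0 subr0.
rewrite /lincomb mulr_sumr -sumrB (bigD1_ord j)//= [X in X + _](_ : _ = 0).
  rewrite add0r; apply: eq_bigr => i _; rewrite mxE; ring.
by field.
Qed.

(** As [r] decreases to 0 these slabs, from which the hyperplane itself is removed, shrink to the
    empty set, and a finite measure is continuous from above. The width [r * \sum_i |f i x|] is the
    change at [x] that [lincomb_near] allows. *)
Lemma small_slab (mu : {finite_measure set E -> \bar R}) n
    (f : 'I_n -> E -> R) (th : 'rV[R]_n) S (e : R) :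
  (forall i, measurable_fun setT (f i)) -> measurable S -> 0 < e ->
  exists2 r : R, 0 < r &
    (mu (S `&` [set x | lincomb f th x <> 0%R /\
       (`|lincomb f th x| <= r * \sum_i `|f i x|)%R]) <= e%:E)%E.
Proof.
move=> mf mS e0.
pose G x : R := \sum_i `|f i x|.
pose C k := S `&` [set x | lincomb f th x <> 0 /\
       `|lincomb f th x| <= k.+1%:R^-1 * G x].
have mg := measurable_lincomb f th mf.
have mG : measurable_fun setT G.
  by apply: measurable_sum => i; apply: measurableT_comp.
have mC k : measurable (C k).
  apply: measurableI => //.
  rewrite (_ : [set _ | _] = (setT `&` lincomb f th @^-1` (~` [set 0])) `&`
     [set x | 0 <= k.+1%:R^-1 * G x - `|lincomb f th x|]).
    apply: measurableI.
      by apply: mg => //; apply: measurableC; exact: measurable_set1.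
    apply: measurable_ge0_set; apply: measurable_funB.
      by apply: measurable_funM => //; exact: measurable_cst.
    exact: measurableT_comp.
  by apply/seteqP; split => x /=; rewrite subr_ge0 => -[]; [|case].
have C0 : \bigcap_k C k = set0.
  rewrite -subset0 => x Cx /=.
  have [_ [gx0 _]] := Cx 0%N I.
  have gx : 0 < `|lincomb f th x| by rewrite normr_gt0; exact/eqP.
  have Gx : 0 <= G x by apply: sumr_ge0.
  have [k kP] : exists k : nat, G x / `|lincomb f th x| < k.+1%:R.
    exists (Num.trunc (G x / `|lincomb f th x|)).
    by rewrite truncnS_gt.
  have [_ [_]] := Cx k I.
  rewrite leNgt => /negP; apply.
  by rewrite ltr_pdivrMl// -ltr_pdivrMr.
have : mu \o C @ \oo --> mu (\bigcap_k C k).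
  apply: nonincreasing_cvg_mu => //.
  - by rewrite ltey_eq fin_num_measure.
  - by rewrite C0.
  - move=> a b ab; apply/subsetPset => x [Sx [? hx]]; split => //; split => //.
    apply: le_trans hx _; rewrite ler_wpM2r ?sumr_ge0//.
    by rewrite lef_pV2 ?posrE ?ltr0n// ler_nat ltnS.
rewrite C0 measure0 => /fine_cvgP[_ /cvgrPdist_lt/(_ _ e0)].
move=> [k _ /(_ k (leqnn _))] /=; rewrite sub0r normrN => hk.
exists k.+1%:R^-1; first by rewrite invr_gt0.
rewrite -[leLHS]fineK; last exact: (fin_num_measure mu _ (mC k)).
by rewrite lee_fin ltW// (le_lt_trans (ler_norm _)).
Qed.

(** Let [t] be within [r] of [th]. Off the hyperplane [N] the sign can change only in a slab of mass
    at most [e / 2]; on [N] one function is eliminated and the induction hypothesis supplies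
    brackets for the remaining ones. *)
Lemma local_bracketing (mu : {finite_measure set E -> \bar R}) n
    (f : 'I_n.+1 -> E -> R) (th : 'rV[R]_n.+1) S (e : R) :
  (forall (f' : 'I_n -> E -> R) S' (e' : R),
    (forall i, measurable_fun setT (f' i)) -> measurable S' -> 0 < e' ->
    exists2 s, brackets mu S' e' s &
      forall t, bracketed S' s [set x | 0 <= lincomb f' t x]) ->
  (forall i, measurable_fun setT (f i)) -> measurable S -> 0 < e ->
  th != 0 ->
  exists2 s, brackets mu S e s &
    \forall t \near th, bracketed S s [set x | 0 <= lincomb f t x].
Proof.
move=> IH mf mS e0 th0.
have [j thj] : exists j, th 0 j != 0.
  apply/not_existsP => h; move/eqP: th0; apply; apply/rowP => j.
  by rewrite mxE; apply/eqP/negPn/negP; exact: h.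
pose N := [set x | lincomb f th x = 0].
have mg := measurable_lincomb f th mf.
have mN : measurable N.
  rewrite (_ : N = setT `&` lincomb f th @^-1` [set 0]).
    by apply: mg => //; exact: measurable_set1.
  by apply/seteqP; split => x //= -[].
have e20 : 0 < e / 2 by rewrite divr_gt0.
have [r r0 rP] := small_slab mu n.+1 f th S (e / 2) mf mS e20.
have [s' bs' cs'] := IH (fun i => f (lift j i)) (S `&` N) (e / 2)
  (fun i => mf _) (measurableI _ _ mS mN) e20.
pose G x : R := \sum_i `|f i x|.
have mG : measurable_fun setT (fun x => r * G x).
  apply: measurable_funM; first exact: measurable_cst.
  by apply: measurable_sum => i; apply: measurableT_comp.
pose A := [set x | 0 <= lincomb f th x - r * G x].
pose B := [set x | 0 <= lincomb f th x + r * G x].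
have mA : measurable A.
  by apply: measurable_ge0_set; exact: measurable_funB.
have mB : measurable B.
  by apply: measurable_ge0_set; exact: measurable_funD.
(* Off [N] the ends are common to all [t] near [th]; on [N] they come from the induction. *)
pose glue (p : set E * set E) :=
  ((A `\` N) `|` (p.1 `&` N), (B `\` N) `|` (p.2 `&` N)).
exists (map glue s').
  move=> _ /mapP[p /bs'[m1 m2 mup] ->] /=; split.
  - by apply: measurableU; [exact: measurableD|exact: measurableI].
  - by apply: measurableU; [exact: measurableD|exact: measurableI].
  set C := S `&` [set x | lincomb f th x <> 0 /\ _] in rP.
  have mC : measurable C.
    rewrite (_ : C = (S `\` N) `&`
      [set x | 0 <= r * G x - `|lincomb f th x|]).
      apply: measurableI; first exact: measurableD.
      apply: measurable_ge0_set; apply: measurable_funB => //.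
      exact: measurableT_comp.
    apply/seteqP; split => x /=; rewrite subr_ge0.
      by move=> [Sx [? ?]].
    by move=> [[Sx ?] ?].
  (* The difference of two glued ends lies in the slab off [N] and in the difference of the old ends
     on [N]; each part receives [e / 2]. *)
  apply: (@le_trans _ _ (mu (C `|` (S `&` N `&` (p.2 `\` p.1))))).
    apply: le_measure; rewrite ?inE.
    - apply: measurableI => //; apply: measurableD;
       by apply: measurableU; [exact: measurableD|exact: measurableI].
    - apply: measurableU => //; apply: measurableI; last exact: measurableD.
      exact: measurableI.
    - move=> x [Sx [[[Bx Nx]|[p2x Nx]] h]]; [left|right].
        split => //; split => //; move: h.
        move=> /not_orP[/not_andP[] // hA _].
        move: Bx hA; rewrite /A /B /= -/(G x) => Bx /negP hA.
        rewrite ler_norml; apply/andP; split; lra.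
      split => //; split => // p1x; apply: h; right; split => //.
  rewrite (splitr e) EFinD; apply: le_trans (leeD rP mup).
  apply: measureU2 => //; apply: measurableI; last exact: measurableD.
  exact: measurableI.
near=> t.
have tP i : `|t 0 i - th 0 i| <= r.
  have : ball th r t by near: t; exact: nbhsx_ballx.
  by move=> [_ /(_ 0 i)]; rewrite /ball /= distrC => /ltW.
pose t' := \row_i (t 0 (lift j i) - t 0 j / th 0 j * th 0 (lift j i)).
have [p ps' [p1 p2]] := cs' t'.
exists (glue p); first exact: map_f.
have near x := lincomb_near f t th r x tP.
split => x [Sx] /=.
  case=> [[Ax Nx]|[p1x Nx]].
    by move: (near x) Ax; rewrite /A /= ler_norml -/(G x) => /andP[]; lra.
  rewrite (lincomb_elim f t th j)//.
  by apply: p1.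
move=> tx; have [Nx|Nx] := pselect (N x); [right|left]; split => //.
  by apply: p2; split => //=; rewrite -(lincomb_elim f t th j).
by move: (near x) tx; rewrite /B /= ler_norml -/(G x) => /andP[]; lra.
Unshelve. all: by end_near. Qed.

(** Induction on the number of functions; an empty combination is 0, so its set is the whole space.
    A positive factor on [t] does not change the set, hence only the compact unit sphere and [t = 0]
    matter. *)
Lemma bracketing (mu : {finite_measure set E -> \bar R}) n
    (f : 'I_n -> E -> R) S (e : R) :
  (forall i, measurable_fun setT (f i)) -> measurable S -> 0 < e ->
  exists2 s, brackets mu S e s &
    forall t, bracketed S s [set x | 0 <= lincomb f t x].
Proof.
elim: n f S e => [|n IH] f S e mf mS e0.
  exists [:: (setT, setT)].
    move=> p; rewrite inE => /eqP ->; split => //=.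
    by rewrite setDT setI0 measure0 lee_fin ltW.
  move=> t; exists (setT, setT); first by rewrite inE.
  by split => // x _ /=; rewrite /lincomb big_ord0.
pose K := [set t : 'rV[R]_n.+1 | `|t| = 1].
have cK : compact K.
  apply: bounded_closed_compact.
    exists 1; split => // M M1 t /= ->; exact: ltW.
  rewrite (_ : K = (fun t : 'rV[R]_n.+1 => `|t|) @^-1` [set 1]) //.
  apply: closed_comp => //.
    by move=> x _; exact: norm_continuous.
(* Valid lists of brackets directed by inclusion: near-covering compactness along this filter
   concatenates finitely many local lists into one that serves the whole sphere. *)
pose F : set_system (seq (set E * set E)) := [set V | exists2 s0,
  brackets mu S e s0 & forall s, brackets mu S e s -> {subset s0 <= s} -> V s].
have FF : Filter F.
  split.
  - by exists [::] => // p; rewrite in_nil.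
  - move=> V W [s1 b1 h1] [s2 b2 h2]; exists (s1 ++ s2).
      by move=> p; rewrite mem_cat => /orP[/b1|/b2].
    move=> s bs ss; split; [apply: h1|apply: h2] => // p ps; apply: ss;
      by rewrite mem_cat ps ?orbT.
  - by move=> V W VW [s bs hs]; exists s => // s' b' /(hs _ b')/VW.
have /(_ _ F (fun s t => bracketed S s [set x | 0 <= lincomb f t x]) FF) :=
  (compact_near_coveringP K).1 cK.
case.
  move=> th Kth.
  have th0 : th != 0.
    by apply/eqP => th0; move: Kth; rewrite /K /= th0 normr0 => /esym/eqP;
      rewrite oner_eq0.
  have [s bs hs] := local_bracketing mu n f th S e IH mf mS e0 th0.
  exists ([set t | bracketed S s [set x | 0 <= lincomb f t x]],
    [set s' : seq (set E * set E) | {subset s <= s'}]) => /=.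
    by split => //; exists s.
  move=> [t s'] /= [[p ps hp] ss']; exists p => //; exact: ss'.
move=> s bs sP.
(* The additional pair serves [t = 0]. *)
exists ((setT, setT) :: s).
  move=> p; rewrite inE => /orP[/eqP ->|/bs//]; split => //=.
  by rewrite setDT setI0 measure0 lee_fin ltW.
move=> t; have [->|t0] := eqVneq t 0.
  exists (setT, setT); first by rewrite inE eqxx.
  split => // x _ /=; rewrite /lincomb big1 // => i _.
  by rewrite mxE mul0r.
have tn : 0 < `|t| by rewrite normr_gt0.
have [] := sP s bs (fun _ => id) (`|t|^-1 *: t).
  by rewrite /K /= normrZ ger0_norm ?invr_ge0// mulVf// gt_eqF.
move=> p ps hp; exists p; first by rewrite inE ps orbT.
suff <- : [set x | 0 <= lincomb f (`|t|^-1 *: t) x] =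
  [set x | 0 <= lincomb f t x] by [].
have tE x : lincomb f (`|t|^-1 *: t) x = `|t|^-1 * lincomb f t x.
  by rewrite /lincomb mulr_sumr; apply: eq_bigr => i _; rewrite mxE mulrA.
by apply/seteqP; split => x /=; rewrite tE pmulr_rge0 ?invr_gt0.
Qed.

End bracketing.

(** * Strong law of large numbers for events *)

(** The bound telescopes: [x ^- 2 <= 2 / x - 2 / (x + 1)] for [x >= 1]. *)
Lemma sum_inv_sqr_le {R : realType} n :
  \sum_(0 <= k < n) (k.+1%:R ^- 2) <= 2 - 2 / n.+1%:R :> R.
Proof.
elim: n => [|n IH]; first by rewrite big_nil divr1 subrr.
rewrite big_nat_recr//=; apply: le_trans (lerD IH (lexx _)) _.
have -> : n.+2%:R = n.+1%:R + 1 :> R by rewrite -natr1.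
have : 1 <= n.+1%:R :> R by rewrite ler1n.
move: (n.+1%:R : R) => x x1.
rewrite -subr_ge0.
have -> : 2 - 2 / (x + 1) - (2 - 2 / x + x ^- 2) =
          (x - 1) / (x ^+ 2 * (x + 1)).
  field; apply/andP; split; apply/eqP; lra.
by rewrite divr_ge0 ?mulr_ge0 ?sqr_ge0 //; lra.
Qed.

Lemma square_sandwich n : (0 < n)%N ->
  exists k : nat, (k.+1 ^ 2 <= n < k.+2 ^ 2)%N.
Proof.
elim: n => // -[_ _|n /(_ erefl) [k kn] _]; first by exists 0%N.
have [h|h] := leqP (k.+2 ^ 2) n.+2; [exists k.+1|exists k]; nia.
Qed.

(** Here [s] and [t] stand for the counts at a square [m] and at a later [n] before the next square.
    The difference of the averages is a gain [(t - s) / n] minus a loss [s * (n - m) / (n * m)],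
    both between 0 and [(n - m) / n], which is at most [2 * q / q ^+ 2]. *)
Lemma average_interpolation {R : realType} (s m n q : R) (t : R) :
  1 <= q -> m = q ^+ 2 -> m <= n -> n - m <= 2 * q ->
  0 <= s <= m -> s <= t <= s + (n - m) ->
  `|t / n - s / m| <= 2 / q.
Proof.
move=> q1 mq mn nm /andP[s0 sm] /andP[st ts].
have m0 : 0 < m by rewrite mq exprn_gt0//; lra.
have n0 : 0 < n by lra.
have q0 : 0 < q by lra.
have -> : t / n - s / m = (t - s) / n - s * (n - m) / (n * m).
  by field; rewrite !gt_eqF.
have b1 : (n - m) / n <= 2 / q.
  rewrite ler_pdivrMr// mulrAC ler_pdivlMr//.
  apply: (@le_trans _ _ (2 * q * q)); first by rewrite ler_wpM2r// ltW.
  by rewrite -mulrA -expr2 -mq; lra.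
have c1 : (t - s) / n <= (n - m) / n.
  by rewrite ler_wpM2r ?invr_ge0 ?(ltW n0)//; lra.
have c0 : 0 <= (t - s) / n by rewrite divr_ge0 ?(ltW n0)//; lra.
have d0 : 0 <= s * (n - m) / (n * m).
  by rewrite divr_ge0// ?mulr_ge0 ?(ltW n0) ?(ltW m0)//; lra.
have d1 : s * (n - m) / (n * m) <= (n - m) / n.
  rewrite (_ : _ / _ = (n - m) / n * (s / m)); last first.
    by field; rewrite !gt_eqF.
  rewrite ler_piMr ?divr_ge0 ?(ltW n0)//; first lra.
  by rewrite ler_pdivrMr// mul1r.
by rewrite ler_norml; apply/andP; split; lra.
Qed.

Section strong_law_events.
Context {dT : measure_display} {T : measurableType dT} {R : realType}.
Variables (Pr : probability T R) (B : nat -> set T) (p : R).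
Hypothesis mB : forall i, measurable (B i).
Hypothesis PB : forall i, Pr (B i) = p%:E.
Hypothesis PBB : forall i j, i != j -> Pr (B i `&` B j) = (p * p)%:E.

Definition hits n (w : T) : R := \sum_(i < n) \1_(B i) w.

Let count_ge0 n w : 0 <= hits n w.
Proof. by apply: sumr_ge0 => i _; rewrite indicE. Qed.

Let mcount n : measurable_fun setT (hits n).
Proof. by apply: measurable_sum => i; exact: measurable_indic. Qed.

Let p_ge0 : 0 <= p.
Proof. by rewrite -lee_fin -(PB 0%N). Qed.

Let integral_count n : (\int[Pr]_w (hits n w)%:E = (n%:R * p)%:E)%E.
Proof.
rewrite (eq_integral (fun w => \sum_(i < n) (\1_(B i) w)%:E)%E); last first.
  by move=> w _; rewrite sumEFin.
rewrite ge0_integral_sum//; last first.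
  by move=> i; apply/measurable_EFinP; exact: measurable_indic.
rewrite (eq_bigr (fun=> p%:E)); last first.
  by move=> i _; rewrite integral_indic// setIT; exact: PB.
by rewrite sumEFin sumr_const card_ord mulr_natl.
Qed.

(** The square expands into indicators of pairwise intersections: the [n] diagonal ones have mass
    [p], the others [p ^+ 2]. *)
Let integral_count_sqr n : (\int[Pr]_w (hits n w ^+ 2)%:E =
  (n%:R * p + (n%:R ^+ 2 - n%:R) * p ^+ 2)%:E)%E.
Proof.
rewrite (eq_integral
  (fun w => \sum_(i < n) \sum_(j < n) (\1_(B i `&` B j) w)%:E)%E); last first.
  move=> w _; rewrite expr2 /hits mulr_suml -sumEFin; apply: eq_bigr => i _.
  rewrite mulr_sumr -sumEFin; apply: eq_bigr => j _.
  by rewrite indicI.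
rewrite ge0_integral_sum//; last 2 first.
- move=> i; apply: emeasurable_sum => j; apply/measurable_EFinP.
  by apply: measurable_indic; exact: measurableI.
- by move=> i w _; apply: sume_ge0 => j _; rewrite lee_fin indicE.
rewrite (eq_bigr (fun=> (p + (n%:R - 1) * p ^+ 2)%:E)); last first.
  move=> i _; rewrite ge0_integral_sum//; last first.
    move=> j; apply/measurable_EFinP.
    by apply: measurable_indic; exact: measurableI.
  rewrite (bigD1 i)//= integral_indic ?setIT ?setIid//.
  rewrite [X in (X + _)%E](_ : _ = p%:E); last exact: PB.
  rewrite (eq_bigr (fun=> (p ^+ 2)%:E)); last first.
    move=> j ji; rewrite integral_indic ?setIT//; last exact: measurableI.
    by apply: PBB; rewrite eq_sym.
  rewrite sumEFin sumr_const -EFinD; congr (_ + _)%:E.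
  rewrite -[LHS]mulr_natl; congr (_ * _).
  rewrite cardC1 card_ord -subn1 natrB//.
  by case: n i => // -[].
rewrite sumEFin sumr_const card_ord -[in LHS]mulr_natl; congr EFin; ring.
Qed.

Let variance_count n :
  (\int[Pr]_w ((hits n w - n%:R * p) ^+ 2)%:E <= n%:R%:E)%E.
Proof.
have mY : measurable_fun setT (fun w => ((hits n w - n%:R * p) ^+ 2)%:E).
  apply/measurable_EFinP; apply: measurable_funX; apply: measurable_funB.
    exact: mcount.
  exact: measurable_cst.
have np0 : 0 <= n%:R * p by rewrite mulr_ge0.
(* The cross term of the square is kept on the left, so that every integrand is nonnegative and the
   integrals may be split. *)
have : (\int[Pr]_w (((hits n w - n%:R * p) ^+ 2)%:E +
    (2 * (n%:R * p))%:E * (hits n w)%:E) =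
  \int[Pr]_w ((hits n w ^+ 2)%:E + ((n%:R * p) ^+ 2)%:E))%E.
  apply: eq_integral => w _; rewrite -EFinM -!EFinD; congr EFin; ring.
have mc : measurable_fun setT (EFin \o hits n) by exact/measurable_EFinP.
rewrite ge0_integralD; [|by []| | exact: mY | |exact: measurable_funeM];
  do ?by move=> w _; rewrite ?mule_ge0 ?lee_fin ?sqr_ge0 ?mulr_ge0.
rewrite ge0_integralZl; [|by []|exact: mc| |by rewrite lee_fin mulr_ge0];
  do ?by move=> w _; rewrite lee_fin.
rewrite integral_count ge0_integralD; [|by []| | | |];
  do ?by move=> w _; rewrite lee_fin sqr_ge0.
2: by apply/measurable_EFinP; exact: measurable_funX.
2: by apply/measurable_EFinP; exact: measurable_cst.
have PrT : (Pr : {measure set T -> \bar R}) [set: T] = 1%E.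
  exact: probability_setT.
rewrite integral_count_sqr integral_cst// PrT mule1 => h.
rewrite -(@leeD2rE _ ((2 * (n%:R * p))%:E * (n%:R * p)%:E)%E)//.
(* The variance equals [n * p * (1 - p)]; the cruder bound [n] is enough. *)
rewrite h -EFinM -!EFinD lee_fin -subr_ge0.
have p1 : p <= 1 by rewrite -lee_fin -(PB 0%N) probability_le1.
have -> : n%:R + 2 * (n%:R * p) * (n%:R * p) -
  (n%:R * p + (n%:R ^+ 2 - n%:R) * p ^+ 2 + (n%:R * p) ^+ 2) =
  n%:R * (1 - p + p ^+ 2) :> R by ring.
by rewrite mulr_ge0// addr_ge0 ?sqr_ge0// subr_ge0.
Qed.

Let Y k w : R := hits (k.+1 ^ 2) w / (k.+1 ^ 2)%:R - p.

Let integral_Y k : (\int[Pr]_w (Y k w ^+ 2)%:E <= (k.+1%:R ^- 2)%:E)%E.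
Proof.
set m := (k.+1 ^ 2)%N.
have m0 : 0 < m%:R :> R by rewrite ltr0n expn_gt0.
rewrite (eq_integral (fun w => (m%:R ^- 2)%:E *
  ((hits m w - m%:R * p) ^+ 2)%:E)%E); last first.
  move=> w _; rewrite -EFinM /Y -/m; congr EFin.
  by field; rewrite gt_eqF.
rewrite ge0_integralZl; [|by []| | |by rewrite lee_fin invr_ge0 sqr_ge0];
  do ?by move=> w _; rewrite lee_fin sqr_ge0.
2: { apply/measurable_EFinP; apply: measurable_funX; apply: measurable_funB.
    exact: mcount.
  exact: measurable_cst. }
apply: (@le_trans _ _ ((m%:R ^- 2)%:E * m%:R%:E)%E).
  by apply: lee_wpmul2l => //; rewrite lee_fin invr_ge0 sqr_ge0.
rewrite -EFinM lee_fin expr2 invfM -mulrA mulVf ?gt_eqF// mulr1.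
by rewrite /m natrX.
Qed.

(** The series of the squares [Y k w ^+ 2] has a finite integral, so it converges almost everywhere
    and its terms tend to 0. *)
Let cvg_Y : {ae Pr, forall w, Y k w @[k --> \oo] --> 0}.
Proof.
have mY k : measurable_fun setT (fun w => (Y k w ^+ 2)%:E).
  apply/measurable_EFinP; apply: measurable_funX; apply: measurable_funB.
    by apply: measurable_funM; [exact: mcount|exact: measurable_cst].
  exact: measurable_cst.
have Y0 k w : (0 <= (Y k w ^+ 2)%:E)%E by rewrite lee_fin sqr_ge0.
pose Z w := (\sum_(k <oo) (Y k w ^+ 2)%:E)%E.
have Z0 w : (0 <= Z w)%E by apply: nneseries_ge0.
have iZ : (\int[Pr]_w Z w <= 2%:E)%E.
  rewrite integral_nneseries//.
  apply: lime_le; first by apply: is_cvg_nneseries => k _ _; exact: integral_ge0.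
  near=> n.
  apply: (@le_trans _ _ (\sum_(0 <= k < n) (k.+1%:R ^- 2)%:E)%E).
    by apply: lee_sum => k _; exact: integral_Y.
  rewrite sumEFin lee_fin; apply: le_trans (sum_inv_sqr_le n) _.
  by rewrite gerBl divr_ge0.
have mZ : measurable_fun setT Z.
  rewrite (_ : Z = fun w => (\sum_(k <oo | k \in predT) (Y k w ^+ 2)%:E)%E) //.
  exact: ge0_emeasurable_sum.
have iZ' : Pr.-integrable setT Z.
  apply/integrableP; split => //.
  under eq_integral => w _ do rewrite gee0_abs//.
  by apply: le_lt_trans iZ _; rewrite ltry.
have := @integrable_ae _ _ _ Pr setT measurableT Z iZ'.
apply: filterS => w /(_ Logic.I) Zw.
have cvgS : cvgn (series (fun k => Y k w ^+ 2)).
  apply: nondecreasing_is_cvgn.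
    by apply/nondecreasing_seqP => n; rewrite seriesSr lerDl sqr_ge0.
  exists (fine (Z w)) => _ [n _ <-].
  rewrite -lee_fin fineK// seriesEnat /= -sumEFin.
  by apply: nneseries_lim_ge.
have /cvgrPdist_lt c0 := cvg_series_cvg_0 cvgS.
apply/cvgrPdist_lt => e e0; near=> k.
rewrite sub0r normrN -(@ltr_pXn2r _ 2)// ?nnegrE// ?(ltW e0)//.
rewrite -normrX -[X in `|X|]opprK normrN -[X in `|X|]sub0r.
by near: k; apply: c0; rewrite exprn_gt0.
Unshelve. all: by end_near. Qed.

Let countD m n w : (m <= n)%N ->
  hits m w <= hits n w <= hits m w + (n%:R - m%:R).
Proof.
elim: n => [|n IH]; first by rewrite leqn0 => /eqP ->; rewrite subrr addr0 lexx.
rewrite leq_eqVlt => /orP[/eqP ->|/IH h]; first by rewrite subrr addr0 lexx.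
rewrite {2 3}/hits big_ord_recr/= -/(hits n w).
have : 0 <= (\1_(B n) w : R) <= 1 by rewrite indicE; case: (_ \in _); rewrite ?lexx ler01.
by rewrite -natr1; lra.
Qed.

(* Along the squares the deviations have summable second moments, and the
   averages vary little between two consecutive squares. *)
Lemma strong_law_events :
  {ae Pr, forall w, n.+1%:R^-1 * hits n.+1 w @[n --> \oo] --> p}.
Proof.
apply: filterS cvg_Y => w /cvgrPdist_lt hY.
apply/cvgrPdist_lt => e e0.
have e20 : 0 < e / 2 by rewrite divr_gt0.
have [K1 _ hK1] := hY _ e20.
(* This makes the interpolation error [2 / k.+1] smaller than [e / 2]. *)
have [K2 hK2] : exists K2 : nat, 4 / e < K2.+1%:R.
  by exists (Num.trunc (4 / e)); rewrite truncnS_gt.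
(* Beyond this square, the square just below [n.+1] has an index [k] that is at least both [K1] and
   [K2]. *)
exists ((maxn K1 K2).+1 ^ 2)%N => // n /= hn.
have [k /andP[k1 k2]] := square_sandwich n.+1 isT.
have kK : (maxn K1 K2 <= k)%N by nia.
have := hK1 k; rewrite /= (leq_trans (leq_maxl _ _) kK) => /(_ isT).
rewrite sub0r normrN /Y => hk.
set m := (k.+1 ^ 2)%N in hk k1.
have h : `|hits n.+1 w / n.+1%:R - hits m w / m%:R| <= 2 / k.+1%:R.
  apply: average_interpolation.
  - by rewrite ler1n.
  - by rewrite /m natrX.
  - by rewrite ler_nat.
  - rewrite -natrB// -natrM ler_nat /m; nia.
  - have := countD 0 m w isT.
    by rewrite (_ : hits 0 w = 0) ?add0r ?subr0// /hits big_ord0.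
  - exact: countD.
have h2 : 2 / k.+1%:R < e / 2.
  rewrite ltr_pdivrMr// mulrAC ltr_pdivlMr//.
  have : 4 / e < k.+1%:R.
    apply: lt_le_trans hK2 _; rewrite ler_nat ltnS.
    exact: leq_trans (leq_maxr _ _) kK.
  rewrite ltr_pdivrMr//; lra.
rewrite distrC [_^-1 * _]mulrC (_ : _ - p =
  (hits n.+1 w / n.+1%:R - hits m w / m%:R) + (hits m w / m%:R - p)).
  apply: le_lt_trans (ler_normD _ _) _.
  by rewrite (splitr e); apply: ltrD => //; exact: le_lt_trans h h2.
by rewrite addrA subrK.
Qed.

End strong_law_events.

(** * Duality for the worst-case mass of a halfspace *)

Section mixture.
Context {d : measure_display} {T : measurableType d} {R : realType}.
Variables (P1 P2 : probability T R) (a b : {nonneg R}).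
Hypothesis ab1 : a%:num + b%:num = 1.

(** The equation on the weights is an argument, so that the instance of probability law can be
    attached to the term. *)
Definition mixture of a%:num + b%:num = 1 : set T -> \bar R :=
  measure_add (mscale a P1) (mscale b P2).

HB.instance Definition _ := Measure.on (mixture ab1).

Lemma mixtureE A :
  mixture ab1 A = (a%:num%:E * P1 A + b%:num%:E * P2 A)%E.
Proof. exact: measure_addE. Qed.

Let mixture_setT : mixture ab1 [set: T] = 1%E.
Proof. by rewrite mixtureE !probability_setT !mule1 -EFinD ab1. Qed.

HB.instance Definition _ :=
  Measure_isProbability.Build _ _ _ (mixture ab1) mixture_setT.

Lemma ge0_integral_mixture (f : T -> \bar R) :
  measurable_fun setT f -> (forall x, 0 <= f x)%E ->
  (\int[mixture ab1]_x f x =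
   a%:num%:E * \int[P1]_x f x + b%:num%:E * \int[P2]_x f x)%E.
Proof.
move=> mf f0.
rewrite [LHS]ge0_integral_measure_add//.
by rewrite !ge0_integral_mscale.
Qed.

End mixture.

(** * Distance to a halfspace and projection onto it *)

Section euclid.
Context {R : realType} {d : nat}.
Implicit Types x y u z : d.-tuple R.

Lemma tnth_vsub x y i : tnth (vsub x y) i = tnth x i - tnth y i.
Proof. by rewrite tnth_mktuple. Qed.

Lemma inner_ge0 x : 0 <= inner x x.
Proof. by apply: sumr_ge0 => i _; rewrite -expr2 sqr_ge0. Qed.

Lemma enorm1 u : enorm u = 1 -> inner u u = 1.
Proof.
by move=> u1; rewrite -(sqr_sqrtr (inner_ge0 u)) -/(enorm u) u1 expr1n.
Qed.

Lemma inner_vsub u x z : inner u (vsub x z) = inner u x - inner u z.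
Proof.
by rewrite /inner -sumrB; apply: eq_bigr => i _; rewrite tnth_vsub mulrBr.
Qed.

(** Cauchy-Schwarz for a unit vector: the squared norm of [x] minus its projection on [u] is
    nonnegative. *)
Lemma inner_le_enorm u x : enorm u = 1 -> inner u x <= enorm x.
Proof.
move=> /enorm1 u1; apply: le_trans (ler_norm _) _.
rewrite -sqrtr_sqr ler_wsqrtr// -subr_ge0.
have <- : \sum_(i < d) (tnth x i - inner u x * tnth u i) ^+ 2 =
    inner x x - inner u x ^+ 2.
  rewrite (eq_bigr (fun i => tnth x i * tnth x i +
    (inner u x ^+ 2 * (tnth u i * tnth u i) -
     2 * inner u x * (tnth u i * tnth x i)))); last by move=> i _; ring.
  rewrite big_split/= sumrB -!mulr_sumr -/(inner u u) u1 -/(inner u x).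
  by rewrite -/(inner x x); ring.
by apply: sumr_ge0 => i _; rewrite sqr_ge0.
Qed.

(** For a unit vector [u] this is the distance of [x] to [halfspace u z], the [g x] of the
    introduction. *)
Definition gap u z x : R := Num.max 0 (- inner u (vsub x z)).

Lemma gap_ge0 u z x : 0 <= gap u z x.
Proof. by rewrite /gap le_max lexx. Qed.

Lemma gap_le_enorm u z x y :
  enorm u = 1 -> halfspace u z x -> gap u z y <= enorm (vsub x y).
Proof.
move=> u1 Hx; rewrite /gap ge_max sqrtr_ge0/=.
apply: le_trans (inner_le_enorm u (vsub x y) u1).
by move: Hx; rewrite /halfspace /= !inner_vsub; lra.
Qed.

Definition ramp (lam : R) u z x : R := Num.max 0 (1 - lam * gap u z x).

Lemma ramp_ge0 lam u z x : 0 <= ramp lam u z x.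
Proof. by rewrite /ramp le_max lexx. Qed.

Lemma ramp_le1 lam u z x : 0 <= lam -> ramp lam u z x <= 1.
Proof. by move=> l0; rewrite /ramp ge_max ler01 gerBl mulr_ge0 ?gap_ge0. Qed.

(** For a unit vector [u], points of [S] are projected onto the halfspace and all others stay in
    place. *)
Definition push u z (S : set (d.-tuple R)) x : d.-tuple R :=
  [tuple tnth x i + \1_S x * gap u z x * tnth u i | i < d].

Lemma enorm_push u z S x : enorm u = 1 ->
  enorm (vsub (push u z S x) x) = \1_S x * gap u z x.
Proof.
move=> /enorm1 u1; set c := \1_S x * gap u z x.
have c0 : 0 <= c by rewrite mulr_ge0 ?gap_ge0// indicE.
rewrite /enorm (_ : inner _ _ = c ^+ 2) ?sqrtr_sqr ?ger0_norm//.
rewrite -[RHS]mulr1 -u1 /inner mulr_sumr; apply: eq_bigr => i _.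
by rewrite tnth_vsub tnth_mktuple -/c; ring.
Qed.

Lemma halfspace_push u z S x : enorm u = 1 -> S x ->
  halfspace u z (push u z S x).
Proof.
move=> /enorm1 u1 Sx; rewrite /halfspace /=.
have -> : inner u (vsub (push u z S x) z) =
    inner u (vsub x z) + gap u z x * inner u u.
  rewrite /inner mulr_sumr -big_split/=; apply: eq_bigr => i _.
  rewrite !tnth_vsub tnth_mktuple (_ : \1_S x = 1) ?indicE ?mem_set//; ring.
rewrite u1 mulr1 /gap -lerBlDl sub0r le_max lexx orbT //.
Qed.

End euclid.

(** * Measurability of the geometric functions *)

Section measurability.
Context {R : realType} {d : nat}.
Implicit Types u z : d.-tuple R.

Lemma measurable_inner_vsub {dX} {X : measurableType dX} u
    (f g : X -> d.-tuple R) :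
  measurable_fun setT f -> measurable_fun setT g ->
  measurable_fun setT (fun x => inner u (vsub (f x) (g x))).
Proof.
move=> /measurable_fun_tnthP mf /measurable_fun_tnthP mg.
rewrite /inner; apply: measurable_sum => i.
apply: measurable_funM; first exact: measurable_cst.
under eq_fun do rewrite tnth_vsub.
by apply: measurable_funB; [exact: mf|exact: mg].
Qed.

Lemma measurable_enorm_vsub {dX} {X : measurableType dX}
    (f g : X -> d.-tuple R) :
  measurable_fun setT f -> measurable_fun setT g ->
  measurable_fun setT (fun x => enorm (vsub (f x) (g x))).
Proof.
move=> /measurable_fun_tnthP mf /measurable_fun_tnthP mg.
apply: (@measurableT_comp _ _ _ _ _ _ (@Num.sqrt R)).
  by apply: continuous_measurable_fun; exact: sqrt_continuous.
apply: measurable_sum => i; under eq_fun do rewrite tnth_vsub.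
by apply: measurable_funM; apply: measurable_funB; do ?[exact: mf|exact: mg].
Qed.

Lemma measurable_gap u z : measurable_fun setT (gap u z).
Proof.
apply: measurable_maxr; first exact: measurable_cst.
apply: measurable_funN; apply: measurable_inner_vsub => //.
Qed.

Lemma measurable_ramp lam u z : measurable_fun setT (ramp lam u z).
Proof.
apply: measurable_maxr; first exact: measurable_cst.
apply: measurable_funB; first exact: measurable_cst.
by apply: measurable_funM; [exact: measurable_cst|exact: measurable_gap].
Qed.

Lemma measurable_halfspace u z : measurable (halfspace u z).
Proof.
by apply: measurable_ge0_set; exact: measurable_inner_vsub.
Qed.

Lemma measurable_push u z S : measurable S ->
  measurable_fun setT (push u z S).
Proof.
move=> mS; apply/measurable_fun_tnthP => i.
rewrite [X in measurable_fun _ X](_ : _ =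
  fun x => tnth x i + \1_S x * gap u z x * tnth u i); last first.
  by apply/funext => x /=; rewrite tnth_mktuple.
apply: measurable_funD; first exact: measurable_tnth.
apply: measurable_funM; last exact: measurable_cst.
by apply: measurable_funM; [exact: measurable_indic|exact: measurable_gap].
Qed.

End measurability.

(** * Weak duality and feasible transports *)

Section duality.
Context {R : realType} {d : nat}.
Variables (Q : probability (d.-tuple R) R) (u z : d.-tuple R).
Hypothesis u1 : enorm u = 1.
Local Open Scope ereal_scope.

Definition worst_case (delta : R) : \bar R :=
  ereal_sup [set (Q' : probability (d.-tuple R) R) (halfspace u z) |
             Q' in [set Q' | wasserstein Q' Q <= delta%:E]].

Definition dual (lam delta : R) : \bar R :=
  (lam * delta)%:E + \int[Q]_x (ramp lam u z x)%:E.

(** Integrate against the coupling the pointwise inequality between the indicator of the halfspace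
    at [p.1] and [lam] times the distance plus the ramp at [p.2]; on the halfspace it follows from
    [gap_le_enorm]. *)
Lemma coupling_bound (Q' : probability (d.-tuple R) R)
    (Pi : probability (d.-tuple R * d.-tuple R)%type R) (lam : R) :
  (0 <= lam)%R -> coupling Q' Q Pi ->
  Q' (halfspace u z) <= lam%:E * \int[Pi]_p (enorm (vsub p.1 p.2))%:E +
    \int[Q]_x (ramp lam u z x)%:E.
Proof.
move=> l0 [c1 c2].
have mH := measurable_halfspace u z.
have mr : measurable_fun setT (EFin \o ramp lam u z).
  by apply/measurable_EFinP; exact: measurable_ramp.
have me : measurable_fun setT
    (fun p : d.-tuple R * d.-tuple R => (enorm (vsub p.1 p.2))%:E).
  by apply/measurable_EFinP; exact: measurable_enorm_vsub.
have -> : \int[Q]_x (ramp lam u z x)%:E =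
    \int[Pi]_p (ramp lam u z p.2)%:E.
  rewrite -[RHS](@ge0_integral_pushforward _ _ _ _ _ snd measurable_snd Pi
     setT (EFin \o ramp lam u z))//.
    by apply: eq_measure_integral => A mA _; exact/esym/c2.
  by move=> x _; rewrite lee_fin ramp_ge0.
have -> : Q' (halfspace u z) = Pi (fst @^-1` halfspace u z).
  exact/esym/c1.
have mfH : measurable (fst @^-1` halfspace u z : set (d.-tuple R * d.-tuple R)).
  by rewrite -[X in measurable X]setTI; exact: measurable_fst.
rewrite -[X in Pi X]setIT -integral_indic//.
have e0 (p : d.-tuple R * d.-tuple R) : 0 <= (enorm (vsub p.1 p.2))%:E.
  by rewrite lee_fin sqrtr_ge0.
have mr2 : measurable_fun setT
    (fun p : d.-tuple R * d.-tuple R => (ramp lam u z p.2)%:E).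
  by apply: (measurableT_comp mr); exact: measurable_snd.
rewrite -ge0_integralZl//.
rewrite -ge0_integralD; [|by []| |exact: measurable_funeM| |exact: mr2];
  do ?by move=> p _; rewrite ?mule_ge0 ?lee_fin ?sqrtr_ge0 ?ramp_ge0.
apply: ge0_le_integral; [by []|by []| | |].
- by apply/measurable_EFinP; exact: measurable_indic.
- by apply: emeasurable_funD => //; exact: measurable_funeM.
move=> p _; rewrite -EFinM -EFinD lee_fin indicE.
case: (boolP (p \in _)) => [/set_mem Hp|_] /=; last first.
  by rewrite addr_ge0 ?ramp_ge0// mulr_ge0 ?sqrtr_ge0.
have h := @gap_le_enorm _ _ u z p.1 p.2 u1 Hp.
have h2 : (1 - lam * gap u z p.2 <= ramp lam u z p.2)%R.
  by rewrite /ramp le_max lexx orbT.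
have := ler_wpM2l l0 h; rewrite mulr1n; lra.
Qed.

Lemma weak_duality (lam delta : R) :
  (0 <= lam)%R -> worst_case delta <= dual lam delta.
Proof.
move=> l0; apply: ge_ereal_sup => _ [Q' /= WQ' <-].
apply/lee_addgt0Pr => e e0.
have l1 : (0 < lam + 1)%R by lra.
(* The infimum over couplings is only approached. Division by [lam + 1] also covers [lam = 0], and
   [lam * (e / (lam + 1))] is at most [e]. *)
have : wasserstein Q' Q < (delta + e / (lam + 1))%:E.
  by apply: le_lt_trans WQ' _; rewrite lte_fin ltrDl divr_gt0.
move=> /ereal_inf_lt[_ [Pi cPi <-]] costPi.
apply: le_trans (coupling_bound Q' Pi lam l0 cPi) _.
rewrite /dual addeAC; apply: leeD => //.
apply: (@le_trans _ _ (lam%:E * (delta + e / (lam + 1))%:E)).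
  by rewrite lee_wpmul2l// ?lee_fin// ltW.
rewrite -EFinM lee_fin mulrDr lerD2l mulrCA -[leRHS]mulr1.
by rewrite ler_wpM2l ?(ltW e0)// ler_pdivrMr// mul1r lerDl.
Qed.

(** The transport cost of [push u z S] under [Q], for a unit vector [u]. *)
Definition cost (S : set (d.-tuple R)) : \bar R :=
  \int[Q]_x (\1_S x * gap u z x)%:E.

(* The mass of [S1] is moved with weight [a], that of [S2] with weight [b],
   along [u] to the boundary of the halfspace. *)
Lemma primal_bound (S1 S2 : set (d.-tuple R)) (a b : {nonneg R}) (delta : R) :
  (a%:num + b%:num = 1)%R -> measurable S1 -> measurable S2 ->
  a%:num%:E * cost S1 + b%:num%:E * cost S2 <= delta%:E ->
  a%:num%:E * Q S1 + b%:num%:E * Q S2 <= worst_case delta.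
Proof.
move=> ab mS1 mS2 le_delta.
have mpush S : measurable S -> measurable_fun setT (push u z S).
  exact: measurable_push.
have mgraph S : measurable S ->
    measurable_fun setT (fun x => (push u z S x, x)).
  by move=> mS; apply: measurable_fun_pair => //; exact: mpush.
pose F S (mS : measurable S) : {mfun _ >-> _} :=
  HB.pack (push u z S) (isMeasurableFun.Build _ _ _ _ _ (mpush S mS)).
pose G S (mS : measurable S) : {mfun _ >-> _} :=
  HB.pack (fun x => (push u z S x, x)) (isMeasurableFun.Build _ _ _ _ _ (mgraph S mS)).
(* [Q'] is the law of the moved point, [Pi] the joint law of the moved and the original point. *)
pose Q' := mixture (distribution Q (F S1 mS1)) (distribution Q (F S2 mS2)) a b ab.
pose Pi := mixture (distribution Q (G S1 mS1)) (distribution Q (G S2 mS2)) a b ab.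
have cPi : coupling Q' Q Pi.
  split=> A mA; first by rewrite [LHS]mixtureE [RHS]mixtureE.
  rewrite [LHS]mixtureE.
  rewrite -ge0_muleDl; do ?by rewrite lee_fin.
  by rewrite -EFinD ab mul1e.
apply: (@le_trans _ _ (Q' (halfspace u z))).
  have mH := measurable_halfspace u z.
  rewrite [leRHS]mixtureE; apply: leeD; apply: lee_wpmul2l; rewrite ?lee_fin//.
    apply: le_measure; rewrite ?inE//.
      by rewrite -[X in measurable X]setTI; exact: (mpush S1 mS1 measurableT _ mH).
    by move=> x S1x; exact: halfspace_push.
  apply: le_measure; rewrite ?inE//.
    by rewrite -[X in measurable X]setTI; exact: (mpush S2 mS2 measurableT _ mH).
  by move=> x S1x; exact: halfspace_push.
apply: ereal_sup_ubound; exists Q' => //=.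
apply: le_trans le_delta; apply: ereal_inf_lbound; exists Pi => //.
have me : measurable_fun setT
    (fun p : d.-tuple R * d.-tuple R => (enorm (vsub p.1 p.2))%:E).
  by apply/measurable_EFinP; exact: measurable_enorm_vsub.
have e0 (p : d.-tuple R * d.-tuple R) : 0 <= (enorm (vsub p.1 p.2))%:E.
  by rewrite lee_fin sqrtr_ge0.
rewrite ge0_integral_mixture// !ge0_integral_distribution//.
congr (_ * _ + _ * _); apply: eq_integral => x _ /=; by rewrite enorm_push.
Qed.

End duality.

(** * Strong duality up to an arbitrarily small error *)

Section strong_duality.
Context {R : realType} {d : nat}.
Variables (Q : probability (d.-tuple R) R) (u z : d.-tuple R).
Hypothesis u1 : enorm u = 1.
Local Open Scope ereal_scope.

Let g := gap u z.
Let level (r : R) : set (d.-tuple R) := [set x | (g x <= r)%R].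

Let measurable_level r : measurable (level r).
Proof.
rewrite (_ : level r = setT `&` g @^-1` `]-oo, r]%classic).
  by apply: (@measurable_gap _ _ u z) => //; exact: measurable_itv.
by apply/seteqP; split => x /=; rewrite in_itv/= // => -[].
Qed.

Let measurable_cost S : measurable S ->
  measurable_fun setT (fun x => (\1_S x * g x)%:E).
Proof.
move=> mS; apply/measurable_EFinP.
by apply: measurable_funM; [exact: measurable_indic|exact: measurable_gap].
Qed.

Let cost_integrand_ge0 S x : 0 <= (\1_S x * g x)%:E.
Proof. by rewrite lee_fin mulr_ge0 ?gap_ge0// indicE. Qed.

Let integral_cstQ (c : R) : \int[Q]_x c%:E = c%:E.
Proof. by rewrite integral_cst// [X in _ * X]probability_setT mule1. Qed.

(** Approximate complementary slackness at [lam = r^-1], from a pointwise inequality: on the level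
    set the two terms on the left add up to 1, and outside it [g x > r - h], so the ramp is at most
    [h / r]. *)
Let level_bound (r h r' : R) : (0 < r)%R -> (0 <= h)%R -> (r - h <= r' <= r)%R ->
  \int[Q]_x (ramp r^-1 u z x)%:E + r^-1%:E * cost Q u z (level r') <=
  Q (level r') + (h / r)%:E.
Proof.
move=> r0 h0 /andP[hr' r'r].
have mr : measurable_fun setT (EFin \o ramp r^-1 u z).
  by apply/measurable_EFinP; exact: measurable_ramp.
have mi : measurable_fun setT (EFin \o (\1_(level r') : _ -> R)).
  by apply/measurable_EFinP; exact: measurable_indic.
have hr0 : (0 <= h / r)%R by rewrite divr_ge0// ltW.
have ri0 : (0 <= r^-1)%R by rewrite invr_ge0 ltW.
have -> : Q (level r') + (h / r)%:E =
    \int[Q]_x ((\1_(level r') x)%:E + (h / r)%:E).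
  rewrite ge0_integralD; [|by []| |exact: mi| |exact: measurable_cst];
    do ?by move=> x _; rewrite lee_fin.
  by rewrite integral_cstQ integral_indic// setIT.
have nn x : 0 <= r^-1%:E * (\1_(level r') x * g x)%:E.
  by apply: mule_ge0 => //; rewrite lee_fin.
rewrite -ge0_integralZl//; last exact: measurable_cost.
rewrite -ge0_integralD; [|by []| |exact: mr|by []|
    by apply: measurable_funeM; exact: measurable_cost];
  last by move=> x _; rewrite lee_fin ramp_ge0.
apply: ge0_le_integral; [by []| | | |].
- by move=> x _; rewrite adde_ge0// lee_fin ramp_ge0.
- apply: emeasurable_funD => //; apply: measurable_funeM; exact: measurable_cost.
- by apply: emeasurable_funD => //; exact: measurable_cst.
move=> x _; rewrite -EFinM -!EFinD lee_fin indicE.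
case: (boolP (x \in _)) => [/set_mem|/negP xn] /=.
  rewrite /level /= => xl.
  rewrite mulr1n /ramp -/g mul1r max_r; first lra.
  by rewrite subr_ge0 mulrC ler_pdivrMr// mul1r; lra.
have xl : (r' < g x)%R by rewrite ltNge; apply/negP => h'; apply: xn; rewrite inE.
rewrite mulr0n mul0r mulr0 addr0 add0r /ramp -/g ge_max hr0/=.
by rewrite -subr_ge0 (_ : _ - _ = (h - r + g x) / r)%R;
  [rewrite divr_ge0 ?(ltW r0)//; lra|field; rewrite gt_eqF].
Qed.

Let cost_level_le (r : R) : (0 <= r)%R -> cost Q u z (level r) <= r%:E.
Proof.
move=> r0; rewrite -(integral_cstQ r); apply: ge0_le_integral => //.
- exact: measurable_cost.
- move=> x _; rewrite lee_fin indicE.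
  case: (boolP (x \in _)) => [/set_mem xl|_] /=; first by rewrite mul1r.
  by rewrite mul0r.
Qed.

(** The levels exhaust the space, and monotone convergence applies. *)
Let cost_levels (h delta : R) : (0 < h)%R ->
  (forall k : nat, cost Q u z (level (k%:R * h)) <= delta%:E) ->
  cost Q u z setT <= delta%:E.
Proof.
move=> h0 kP.
pose f k x := (\1_(level (k%:R * h)) x * g x)%:E.
have cf x : f k x @[k --> \oo] --> (\1_setT x * g x)%:E.
  apply: cvg_near_cst.
  exists (Num.trunc (g x / h)).+1 => // k /= hk; rewrite /f !indicE.
  rewrite in_setT mem_set// /level /= -ler_pdivrMr//.
  apply: le_trans (ltW (truncnS_gt _)) _; by rewrite ler_nat.
have f0 k x : 0 <= f k x by exact: cost_integrand_ge0.
have nd x m n : (m <= n)%N -> f m x <= f n x.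
  move=> mn; rewrite lee_fin ler_wpM2r ?gap_ge0// !indicE ler_nat.
  case: (boolP (x \in level (m%:R * h))) => // /set_mem xm.
  rewrite mem_set// /level /=; apply: le_trans xm _.
  by rewrite ler_wpM2r ?(ltW h0)// ler_nat.
rewrite /cost (eq_integral (fun x => limn (f ^~ x))); last first.
  by move=> x _; apply/esym/cvg_lim => //; exact: cf.
rewrite monotone_convergence//.
- apply: lime_le.
    apply: ereal_nondecreasing_is_cvgn => m n mn.
    apply: ge0_le_integral => //; do ?exact: measurable_cost.
    by move=> x _; exact: nd.
  by apply: nearW => k; exact: kP.
- by move=> k; exact: measurable_cost.
- by move=> x _ m n; exact: nd.
Qed.

(* Restricting the levels to multiples of [h] costs at most [h / delta] and
   avoids the one-sided limits of the cost at the exact threshold. *)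
Lemma strong_duality (delta e : R) : (0 < delta)%R -> (0 < e)%R ->
  exists2 lam, (0 <= lam)%R &
    dual Q u z lam delta <= worst_case Q u z delta + e%:E.
Proof.
move=> d0 e0; set h := (e * delta)%R.
have h0 : (0 < h)%R by rewrite mulr_gt0.
(* If every level is affordable, all the mass can be moved into the halfspace: the worst case is 1,
   which is the dual value at [lam = 0]. *)
have [kP|] := pselect (forall k : nat, cost Q u z (level (k%:R * h)) <= delta%:E).
  exists 0%R => //; rewrite /dual mul0r add0e.
  have -> : \int[Q]_x (ramp 0 u z x)%:E = 1.
    rewrite -[RHS](integral_cstQ 1); apply: eq_integral => x _.
    by rewrite /ramp mul0r subr0 max_r.
  have c0 := cost_levels h delta h0 kP.
  apply: (@le_trans _ _ (worst_case Q u z delta)); last first.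
    by rewrite leeDl// lee_fin ltW.
  have := primal_bound Q u z u1 setT setT (NngNum ler01) (NngNum (lexx 0%R)) delta (addr0 _)
    measurableT measurableT.
  rewrite /= !mul1e !mul0e !adde0 => /(_ c0).
  by apply: le_trans; rewrite [leRHS]probability_setT.
move=> /existsNP kP.
have {}kP : exists k : nat, `[< delta%:E < cost Q u z (level (k%:R * h)) >].
  by case: kP => k /negP; rewrite -ltNge => ?; exists k; exact/asboolP.
(* [j.+1] is the first multiple of [h] whose level exceeds the budget; it is not 0, since the level
   0 costs nothing. *)
have := ex_minnP kP => -[[|j]] /asboolP kd kmin.
  exfalso; move: kd; rewrite mul0r ltNge => /negP; apply.
  by apply: le_trans (cost_level_le 0 (lexx _)) _; rewrite lee_fin ltW.
have jd : cost Q u z (level (j%:R * h)) <= delta%:E.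
  rewrite leNgt; apply/negP => hj.
  by have := kmin j (asboolT hj); rewrite ltnn.
set r := (j.+1%:R * h)%R in kd.
have r0 : (0 < r)%R by rewrite mulr_gt0.
have jr : (j%:R * h = r - h)%R by rewrite /r -natr1; ring.
have jh0 : (0 <= j%:R * h)%R by rewrite mulr_ge0// ltW.
set S2 := level (j%:R * h) in jd.
have cge0 S : 0 <= cost Q u z S by apply: integral_ge0 => x _; exact: cost_integrand_ge0.
have c1r := cost_level_le r (ltW r0).
have f1 : cost Q u z (level r) \is a fin_num.
  by rewrite ge0_fin_numE// (le_lt_trans c1r) ?ltry.
have f2 : cost Q u z S2 \is a fin_num.
  by rewrite ge0_fin_numE// (le_lt_trans jd) ?ltry.
have b1 := level_bound r h r r0 (ltW h0).
have b2 := level_bound r h (j%:R * h) r0 (ltW h0).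
have fr : \int[Q]_x (ramp r^-1 u z x)%:E \is a fin_num.
  rewrite ge0_fin_numE; last by apply: integral_ge0 => x _; rewrite lee_fin ramp_ge0.
  apply: (@le_lt_trans _ _ 1); last by rewrite ltry.
  rewrite -(integral_cstQ 1); apply: ge0_le_integral => //.
  - by move=> x _; rewrite lee_fin ramp_ge0.
  - by apply/measurable_EFinP; exact: measurable_ramp.
  - by move=> x _; rewrite lee_fin ramp_le1// invr_ge0 ltW.
have q1 := fin_num_measure Q _ (measurable_level r).
have q2 := fin_num_measure Q _ (measurable_level (j%:R * h)).
have pb := primal_bound Q u z u1 (level r) S2.
rewrite -/S2 in b2 q2.
move: kd jd c1r b1 b2 pb.
rewrite /dual -(fineK f1) -(fineK f2) -(fineK fr) -(fineK q1) -(fineK q2).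
set c1 := fine (cost _ _ _ (level r)); set c2 := fine (cost _ _ _ S2).
set I := fine (\int[Q]_x _); set p1 := fine (Q (level r)); set p2 := fine (Q S2).
rewrite -!EFinM -!EFinD !lee_fin lte_fin.
move=> c1d c2d c1r /(_ _)b1 /(_ _)b2 pb.
have {}b1 : (I + r^-1 * c1 <= p1 + h / r)%R by apply: b1; lra.
have {}b2 : (I + r^-1 * c2 <= p2 + h / r)%R by apply: b2; lra.
have c12 : (0 < c1 - c2)%R by lra.
(* The weights for which the mixture of the two levels spends exactly [delta]. *)
have a0 : (0 <= (delta - c2) / (c1 - c2))%R by rewrite divr_ge0 ?(ltW c12)//; lra.
have b0 : (0 <= (c1 - delta) / (c1 - c2))%R by rewrite divr_ge0 ?(ltW c12)//; lra.
have ab : ((delta - c2) / (c1 - c2) + (c1 - delta) / (c1 - c2) = 1)%R.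
  by field; rewrite gt_eqF.
exists r^-1%R; first by rewrite invr_ge0 ltW.
have := pb (NngNum a0) (NngNum b0) delta ab (measurable_level _) (measurable_level _).
rewrite /= -!EFinM -!EFinD lee_fin.
have dE : ((delta - c2) / (c1 - c2) * c1 + (c1 - delta) / (c1 - c2) * c2 = delta)%R.
  by field; rewrite gt_eqF.
rewrite dE => /(_ (lexx _)) pb'.
apply: le_trans (leeD pb' (lexx e%:E)).
rewrite /dual -(fineK fr) -/I -!EFinD lee_fin.
(* Indeed [delta < c1 <= r] and [h = e * delta]. *)
have hr : (h / r <= e)%R.
  by rewrite ler_pdivrMr// /h ler_wpM2l ?(ltW e0)//; lra.
move: a0 b0 ab dE b1 b2.
set a := (_ / _)%R; set b := (_ / _)%R => a0 b0 ab dE b1 b2.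
have {}b1 := ler_wpM2l a0 b1.
have {}b2 := ler_wpM2l b0 b2.
have bE : (b = 1 - a)%R by lra.
have -> : (r^-1 * delta + I = a * (I + r^-1 * c1) + b * (I + r^-1 * c2))%R.
  by rewrite -{1}dE bE; ring.
apply: le_trans (lerD b1 b2) _; rewrite bE.
have -> : (a * (p1 + h / r) + (1 - a) * (p2 + h / r) = a * p1 + (1 - a) * p2 + h / r)%R.
  by ring.
by rewrite lerD2l.
Qed.

End strong_duality.

(** * Stability of the depth and uniform convergence *)

Lemma sum_ltn_minn n t : (\sum_(k < n) (k < t) = minn n t)%N.
Proof.
elim: n => [|n IH]; first by rewrite big_ord0 min0n.
by rewrite big_ord_recr/= IH; lia.
Qed.

Lemma sum_le_minn_trunc {R : realType} n (y : R) : 0 <= y ->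
  \sum_(k < n) (k.+1%:R <= y)%R%:R = (minn n (Num.trunc y))%:R :> R.
Proof.
move=> y0; rewrite -sum_ltn_minn natr_sum; apply: eq_bigr => k _.
by rewrite truncn_ge_nat.
Qed.

(** * Integrals of ramps under two laws close on halfspaces *)

Section ramp.
Context {R : realType} {d : nat}.
Implicit Types a u z : d.-tuple R.

(** The vector [a] may vanish, as it does for the superlevel sets of the ramp with [lam = 0]. *)
Definition affine_halfspace a (b : R) : set (d.-tuple R) :=
  [set x | 0 <= inner a x + b].

Lemma measurable_affine_halfspace a b : measurable (affine_halfspace a b).
Proof.
apply: measurable_ge0_set; apply: measurable_funD; last exact: measurable_cst.
apply: measurable_sum => i; apply: measurable_funM; first exact: measurable_cst.
exact: measurable_tnth.
Qed.

Lemma halfspaceE u z : halfspace u z = affine_halfspace u (- inner u z).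
Proof.
by apply/seteqP; split => x; rewrite /halfspace /affine_halfspace /= inner_vsub.
Qed.

Definition scale (lam : R) u : d.-tuple R := [tuple lam * tnth u i | i < d].

(** As [t > 0], the outer maximum may be dropped, and as [t <= 1], so may the one inside [gap]. *)
Lemma ramp_superlevel (lam : R) u z (t : R) : 0 <= lam -> 0 < t <= 1 ->
  [set x | t <= ramp lam u z x] =
  affine_halfspace (scale lam u) (1 - t - lam * inner u z).
Proof.
move=> l0 /andP[t0 t1].
have E x : inner (scale lam u) x + (1 - t - lam * inner u z) =
    1 - t + lam * inner u (vsub x z).
  rewrite inner_vsub (_ : inner (scale lam u) x = lam * inner u x); first by ring.
  by rewrite /inner mulr_sumr; apply: eq_bigr => i _; rewrite tnth_mktuple mulrA.
apply/seteqP; split => x; rewrite /affine_halfspace /= E /ramp /gap le_max.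
  rewrite leNgt t0 /= => h.
  have := ler_wpM2l l0 (_ : - inner u (vsub x z) <= Num.max 0 (- inner u (vsub x z))).
  rewrite le_max lexx orbT => /(_ isT); lra.
move=> h; rewrite leNgt t0 /=.
by case: (leP 0 (- inner u (vsub x z))) => _; lra.
Qed.

Local Open Scope ereal_scope.

(** A discrete layer-cake formula: up to [m%:R^-1], the ramp is the average of the indicators of [m]
    superlevel sets. These are halfspaces, and an average of errors [eps] is again [eps]. *)
Lemma ramp_integral_le (P Q : probability (d.-tuple R) R) (eps lam : R) u z :
  (0 <= lam)%R ->
  (forall a b, P (affine_halfspace a b) <= Q (affine_halfspace a b) + eps%:E) ->
  \int[P]_x (ramp lam u z x)%:E <= \int[Q]_x (ramp lam u z x)%:E + eps%:E.
Proof.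
move=> l0 PQ; apply/lee_addgt0Pr => e e0.
set m := (Num.trunc e^-1).+1.
have m0 : (0 < m%:R :> R)%R by rewrite ltr0n.
have me : (m%:R^-1 <= e)%R.
  by rewrite invf_ple ?posrE// ltW// truncnS_gt.
pose H (k : nat) := [set x | (k.+1%:R / m%:R <= ramp lam u z x)%R].
have HE (k : 'I_m) : exists a b, H k = affine_halfspace a b.
  exists (scale lam u), (1 - k.+1%:R / m%:R - lam * inner u z)%R.
  apply: ramp_superlevel => //.
  by rewrite divr_gt0//= ler_pdivrMr// mul1r ler_nat ltn_ord.
have mH (k : 'I_m) : measurable (H k).
  by have [a [b ->]] := HE k; exact: measurable_affine_halfspace.
have mi (k : 'I_m) : measurable_fun setT (EFin \o (\1_(H k) : _ -> R)).
  by apply/measurable_EFinP; exact: measurable_indic.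
pose step x : \bar R := \sum_(k < m) (\1_(H k) x)%:E.
have step0 x : 0 <= step x by apply: sume_ge0 => k _; rewrite lee_fin indicE.
have stepE x : step x = (minn m (Num.trunc (m%:R * ramp lam u z x)))%:R%:E.
  rewrite /step sumEFin -sum_le_minn_trunc ?mulr_ge0 ?ramp_ge0//; congr EFin.
  apply: eq_bigr => k _; rewrite indicE; congr (_%:R)%R; congr nat_of_bool.
  rewrite mulrC -ler_pdivrMr//; apply/idP/idP => [/set_mem//|h].
  exact: mem_set.
have mstep : measurable_fun setT step by exact: emeasurable_sum.
have mr : measurable_fun setT (EFin \o ramp lam u z).
  by apply/measurable_EFinP; exact: measurable_ramp.
have istep (M : probability (d.-tuple R) R) :
    \int[M]_x step x = \sum_(k < m) M (H k).
  rewrite ge0_integral_sum//.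
  by apply: eq_bigr => k _; rewrite integral_indic// setIT.
have mi0 : (0 <= m%:R^-1 :> R)%R by rewrite invr_ge0.
have lo x : m%:R^-1%:E * step x <= (ramp lam u z x)%:E.
  rewrite stepE -EFinM lee_fin mulrC ler_pdivrMr// [leRHS]mulrC.
  apply: (@le_trans _ _ (Num.trunc (m%:R * ramp lam u z x))%:R).
    by rewrite ler_nat geq_minr.
  by rewrite truncn_le mulr_ge0 ?ramp_ge0.
have hi x : (ramp lam u z x)%:E <= m%:R^-1%:E * step x + e%:E.
  rewrite stepE -EFinM -EFinD lee_fin.
  apply: (@le_trans _ _ (m%:R^-1 * (Num.trunc (m%:R * ramp lam u z x)).+1%:R)%R).
    by rewrite ler_pdivlMl// ltW// truncnS_gt.
  rewrite -natr1 mulrDr mulr1 lerD// (minn_idPr _)//.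
  rewrite -(ler_nat R) (@le_trans _ _ (m%:R * ramp lam u z x)%R)//.
    by rewrite truncn_le mulr_ge0 ?ramp_ge0.
  by rewrite ler_piMr// ramp_le1.
have cstep (M : probability (d.-tuple R) R) :
    \int[M]_x (m%:R^-1%:E * step x) = m%:R^-1%:E * \sum_(k < m) M (H k).
  by rewrite ge0_integralZl// istep.
apply: (@le_trans _ _ (\int[P]_x (m%:R^-1%:E * step x + e%:E))).
  apply: ge0_le_integral => //.
  - by move=> x _; rewrite lee_fin ramp_ge0.
  - by apply: emeasurable_funD; [exact: measurable_funeM|exact: measurable_cst].
rewrite ge0_integralD; [|by []| | | |exact: measurable_cst]; last 3 first.
- by move=> x _; rewrite mule_ge0.
- exact: measurable_funeM.
- by move=> x _; rewrite lee_fin ltW.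
rewrite integral_cst// [X in _ + _ * X](_ : _ = 1) ?mule1; last exact: probability_setT.
apply: leeD => //; rewrite cstep.
apply: (@le_trans _ _ (m%:R^-1%:E * \sum_(k < m) Q (H k) + eps%:E)); last first.
  apply: leeD => //; rewrite -cstep; apply: ge0_le_integral => //.
  - by move=> x _; rewrite mule_ge0.
  - exact: measurable_funeM.
apply: (@le_trans _ _ (m%:R^-1%:E * \sum_(k < m) (Q (H k) + eps%:E))).
  apply: lee_wpmul2l => //; apply: lee_sum => k _.
  by have [a [b ->]] := HE k; exact: PQ.
rewrite big_split/= muleDr//; last by rewrite sumEFin fin_num_adde_defl.
rewrite sumEFin sumr_const card_ord -EFinM -[(eps *+ m)%R]mulr_natl mulrA mulVf ?mul1r//.
by rewrite gt_eqF.
Qed.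

End ramp.

(** * Stability of the robust depth *)

Section depth_stability.
Context {R : realType} {d : nat}.
Hypothesis d_gt0 : (0 < d)%N.
Implicit Types (u z : d.-tuple R) (P Q : probability (d.-tuple R) R).
Local Open Scope ereal_scope.

(** In dimension 0 there is no unit vector, and the depth would be the infimum of an empty set,
    [+oo]. *)
Lemma enorm1_exists : exists u, enorm u = 1%R.
Proof.
pose i0 := Ordinal d_gt0.
exists [tuple (i == i0)%:R%R | i < d].
rewrite /enorm /inner (bigD1 i0)//= big1 => [|i /negPf ii0];
  rewrite !tnth_mktuple.
  by rewrite eqxx mulr1 addr0 sqrtr1.
by rewrite ii0 mul0r.
Qed.

(** Deduced from strong duality, the dual value being nonnegative; no law within [delta] of [Q] has
    to be exhibited. *)
Lemma worst_case_ge0 Q u z (delta : R) : (0 < delta)%R -> enorm u = 1%R ->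
  0 <= worst_case Q u z delta.
Proof.
move=> d0 u1; apply/lee_addgt0Pr => e e0.
have [lam l0] := strong_duality Q u z u1 delta e d0 e0.
apply: le_trans; rewrite /dual adde_ge0 ?lee_fin ?mulr_ge0 ?(ltW d0)//.
by apply: integral_ge0 => x _; rewrite lee_fin ramp_ge0.
Qed.

Lemma worst_case_le1 Q u z (delta : R) : worst_case Q u z delta <= 1.
Proof.
apply: ge_ereal_sup => _ [Q' _ <-].
by apply: probability_le1; exact: measurable_halfspace.
Qed.

Lemma robust_depth_fin_num Q z (delta : R) : (0 <= delta)%R ->
  robust_depth delta z Q \is a fin_num.
Proof.
move=> d0; have [u u1] := enorm1_exists.
apply/fin_numPlt/andP; split.
  apply: (@lt_le_trans _ _ 0); first exact: ltNy0.
  rewrite /robust_depth; case: eqP => [_|/eqP dn0].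
    by apply: le_ereal_inf_tmp => _ [v _ <-].
  apply: le_ereal_inf_tmp => _ [v v1 <-]; apply: worst_case_ge0 => //.
  by rewrite lt_neqAle eq_sym dn0.
apply: (@le_lt_trans _ _ 1); last exact: ltry.
rewrite /robust_depth; case: eqP => _.
  apply: le_trans (probability_le1 Q (measurable_halfspace u z)).
  by apply: ereal_inf_lbound; exists u.
apply: le_trans (worst_case_le1 Q u z delta).
by apply: ereal_inf_lbound; exists u.
Qed.

(** A multiplier that is almost optimal for [Q] is inserted into weak duality for [P]. *)
Lemma worst_case_le P Q (eps : R) u z (delta : R) :
  (0 < delta)%R -> enorm u = 1%R ->
  (forall a b, P (affine_halfspace a b) <= Q (affine_halfspace a b) + eps%:E) ->
  worst_case P u z delta <= worst_case Q u z delta + eps%:E.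
Proof.
move=> d0 u1 PQ; apply/lee_addgt0Pr => e e0.
have [lam l0 lamP] := strong_duality Q u z u1 delta e d0 e0.
apply: le_trans (weak_duality P u z u1 lam delta l0) _.
apply: (@le_trans _ _ (dual Q u z lam delta + eps%:E)).
  by rewrite /dual -addeA; apply: leeD => //; exact: ramp_integral_le.
by rewrite [leRHS]addeAC; apply: leeD.
Qed.

Lemma robust_depth_le P Q (eps : R) z (delta : R) : (0 <= delta)%R ->
  (forall a b, P (affine_halfspace a b) <= Q (affine_halfspace a b) + eps%:E) ->
  robust_depth delta z P <= robust_depth delta z Q + eps%:E.
Proof.
move=> d0 PQ; rewrite -leeBlDr//.
rewrite /robust_depth; case: eqP => [_|/eqP dn0]; apply: le_ereal_inf_tmp => _ [u u1 <-].
  rewrite leeBlDr//; apply: (@le_trans _ _ (P (halfspace u z))).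
    by apply: ereal_inf_lbound; exists u.
  by rewrite halfspaceE.
rewrite leeBlDr//; apply: (@le_trans _ _ (worst_case P u z delta)).
  by apply: ereal_inf_lbound; exists u.
by apply: worst_case_le => //; rewrite lt_neqAle eq_sym dn0.
Qed.

Lemma robust_depth_dist P Q (eps : R) z (delta : R) : (0 <= delta)%R ->
  (forall a b, P (affine_halfspace a b) <= Q (affine_halfspace a b) + eps%:E) ->
  (forall a b, Q (affine_halfspace a b) <= P (affine_halfspace a b) + eps%:E) ->
  `|robust_depth delta z P - robust_depth delta z Q| <= eps%:E.
Proof.
move=> d0 PQ QP.
have := robust_depth_le P Q eps z delta d0 PQ.
have := robust_depth_le Q P eps z delta d0 QP.
rewrite -(fineK (robust_depth_fin_num P z delta d0)).
rewrite -(fineK (robust_depth_fin_num Q z delta d0)).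
rewrite -EFinB -!EFinD abse_EFin !lee_fin ler_norml => h1 h2.
by apply/andP; split; lra.
Qed.

End depth_stability.

(** * The Glivenko-Cantelli theorem for halfspaces *)

Section glivenko_cantelli.
Context {R : realType} {d : nat} (P : probability (d.-tuple R) R)
  {dT : measure_display} {T : measurableType dT} (Pr : probability T R)
  (X : nat -> {RV Pr >-> d.-tuple R}).
Hypothesis X_indep : mutually_independent X.
Hypothesis X_law : forall i (A : set (d.-tuple R)), measurable A ->
  distribution Pr (X i) A = P A.
Local Open Scope ereal_scope.

Let sample w i := X i w.

Let Pn w n : probability (d.-tuple R) R := empirical (sample w) n.

Lemma empirical_cvg (A : set (d.-tuple R)) : measurable A ->
  {ae Pr, forall w, Pn w n A @[n --> \oo] --> P A}.
Proof.
move=> mA.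
pose B i := X i @^-1` A.
have mB i : measurable (B i).
  by rewrite -[X in measurable X]setTI; exact: measurable_funP.
have fA := fin_num_measure P A mA.
have PB i : Pr (B i) = (fine (P A))%:E by rewrite fineK//; exact: X_law.
have PBB i j : i != j -> Pr (B i `&` B j) = (fine (P A) * fine (P A))%:E.
  (* Pairwise independence is mutual independence for a list of two indices. *)
  move=> ij; have := X_indep [:: i; j] (fun=> A).
  rewrite /= inE ij => /(_ isT (fun _ _ => mA)).
  rewrite !big_cons big_nil mule1 -/(B i) -/(B j) !PB -EFinM => <-.
  congr (Pr _); apply/seteqP; split.
    by move=> w [Bi Bj] k /=; rewrite !inE => /orP[/eqP->|/eqP->].
  by move=> w h; split; apply: h; rewrite /= !inE eqxx ?orbT.
apply: filterS (strong_law_events Pr B (fine (P A)) mB PB PBB) => w hw.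
rewrite -(fineK fA).
(* The empirical law of index [n] averages [n.+1] points. *)
rewrite [X in X @ _ --> _](_ : _ =
  fun n => (n.+1%:R^-1 * hits B n.+1 w)%:E); last first.
  apply/funext => n; rewrite /Pn /= /empirical /mscale /= /msum EFinM.
  congr (_ * _); rewrite /hits -sumEFin; apply: eq_bigr => i _.
  by rewrite indicE; exact: diracE.
by apply/fine_cvgP; split; [exact: nearW|exact: hw].
Qed.

(** The constant 1 is added to the coordinates, which turns affine inequalities into linear ones in
    [d.+1] functions. *)
Let coord (i : 'I_d.+1) (x : d.-tuple R) : R :=
  if unlift ord0 i is Some j then tnth x j else 1%R.

Let affine_halfspaceE a (b : R) : exists th,
  affine_halfspace a b = [set x | (0 <= lincomb coord th x)%R].
Proof.
exists (\row_i (if unlift ord0 i is Some j then tnth a j else b))%R.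
suff E x : (lincomb coord (\row_i (if unlift ord0 i is Some j then tnth a j else b)) x =
    inner a x + b)%R.
  by apply/seteqP; split => x; rewrite /affine_halfspace /= E.
rewrite /lincomb big_ord_recl /coord !mxE unlift_none mulr1 addrC.
by congr (_ + _)%R; apply: eq_bigr => i _; rewrite mxE liftK.
Qed.

Lemma glivenko_cantelli : {ae Pr, forall w, forall e : R, (0 < e)%R ->
  \forall n \near \oo, forall a b,
    Pn w n (affine_halfspace a b) <= P (affine_halfspace a b) + e%:E /\
    P (affine_halfspace a b) <= Pn w n (affine_halfspace a b) + e%:E}.
Proof.
have mcoord i : measurable_fun setT (coord i).
  rewrite /coord; case: unlift => [j|]; last exact: measurable_cst.
  exact: measurable_tnth.
have h0 (m : nat) : (0 < m.+1%:R^-1 :> R)%R by rewrite invr_gt0.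
have br m := bracketing P _ coord setT m.+1%:R^-1 mcoord measurableT (h0 m).
(* The exceptional null set must not depend on [e]; hence the countably many tolerances
   [m.+1%:R^-1], each with its own finite list of brackets. *)
have ae m : {ae Pr, forall w, forall e : R, (m.+1%:R^-1 < e)%R ->
  \forall n \near \oo, forall a b,
    Pn w n (affine_halfspace a b) <= P (affine_halfspace a b) + e%:E /\
    P (affine_halfspace a b) <= Pn w n (affine_halfspace a b) + e%:E}.
  have [s bs cs] := br m.
  have : {ae Pr, forall w, forall p, p \in s ->
      Pn w n p.1 @[n --> \oo] --> P p.1 /\ Pn w n p.2 @[n --> \oo] --> P p.2}.
    elim: {cs}s bs => [|p s IH] bs; first exact: aeW.
    have [m1 m2 _] := bs p (mem_head _ _).
    have {}IH := IH (fun q qs => bs q (@mem_behead _ (p :: s) q qs)).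
    apply: filterS (filterI (filterI (empirical_cvg _ m1)
      (empirical_cvg _ m2)) IH) => w [[c1 c2] c3] q; rewrite inE => /orP[/eqP ->//|].
    exact: c3.
  apply: filterS => w hw e me.
  pose e' : R := (e - m.+1%:R^-1)%R.
  have e'0 : (0 < e')%R by rewrite subr_gt0.
  have : \forall n \near \oo, forall p, p \in s ->
      P p.1 <= Pn w n p.1 + e'%:E /\ Pn w n p.2 <= P p.2 + e'%:E.
    elim: {cs}s bs hw => [|p s IH] bs hw; first exact: nearW.
    have [m1 m2 _] := bs p (mem_head _ _).
    have {}IH := IH (fun q qs => bs q (@mem_behead _ (p :: s) q qs))
      (fun q qs => hw q (@mem_behead _ (p :: s) q qs)).
    have [c1 c2] := hw p (mem_head _ _).
    have f1 := fin_num_measure P _ m1; have f2 := fin_num_measure P _ m2.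
    have n1 : \forall n \near \oo, P p.1 <= Pn w n p.1 + e'%:E.
      move: c1; rewrite -(fineK f1) => /fine_cvgP[_ /cvgrPdist_le/(_ _ e'0)].
      apply: filterS => n /=; rewrite ler_norml => /andP[_ h].
      rewrite -(fineK (fin_num_measure (Pn w n) _ m1)) -EFinD lee_fin; lra.
    have n2 : \forall n \near \oo, Pn w n p.2 <= P p.2 + e'%:E.
      move: c2; rewrite -(fineK f2) => /fine_cvgP[_ /cvgrPdist_le/(_ _ e'0)].
      apply: filterS => n /=; rewrite ler_norml => /andP[h _].
      rewrite -(fineK (fin_num_measure (Pn w n) _ m2)) -EFinD lee_fin; lra.
    apply: filterS (filterI (filterI n1 n2) IH) => n [[h1 h2] h3] q.
    by rewrite inE => /orP[/eqP ->//|]; exact: h3.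
  apply: filterS => n hn a b.
  have mHab := measurable_affine_halfspace a b.
  have [th Hth] := affine_halfspaceE a b.
  have [p ps [p1 p2]] := cs th; rewrite -Hth !setTI in p1 p2.
  have [m1 m2] := bs p ps; rewrite setTI => mu.
  have [h1 h2] := hn p ps.
  (* From here on a halfspace is compared with the ends of its bracket, where the two laws differ by
     at most [e'] in the required direction. *)
  have P21 : P p.2 <= P p.1 + m.+1%:R^-1%:E.
    apply: (@le_trans _ _ (P (p.1 `|` (p.2 `\` p.1)))).
      apply: le_measure; rewrite ?inE//.
        by apply: measurableU => //; exact: measurableD.
      by move=> x p2x; have [|] := pselect (p.1 x); [left|right].
    apply: le_trans (measureU2 _ m1 (measurableD m2 m1)) _.
    exact: leeD.
  have eE : e%:E = m.+1%:R^-1%:E + e'%:E.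
    by rewrite -EFinD /e' addrC subrK.
  have mono (M : probability (d.-tuple R) R) U V : measurable U ->
    measurable V -> U `<=` V -> M U <= M V.
    by move=> mU mV UV; apply: le_measure; rewrite ?inE.
  split.
    apply: le_trans (mono (Pn w n) _ _ mHab m2 p2) _.
    apply: le_trans h2 _; rewrite eE addeA; apply: leeD => //.
    apply: le_trans P21 _; apply: leeD => //; exact: mono.
  apply: le_trans (mono P _ _ mHab m2 p2) _.
  apply: le_trans P21 _; rewrite eE [X in _ <= _ + X]addeC addeA.
  apply: leeD => //; apply: le_trans h1 _; apply: leeD => //; exact: mono.
have := ae_foralln ae; apply: filterS => w hw e e0.
apply: (hw (Num.trunc e^-1)).
by rewrite invf_plt ?posrE// truncnS_gt.
Qed.

End glivenko_cantelli.

Theorem proposition5 (R : realType) (d : nat) (hd : (0 < d)%N)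
    (P : probability (d.-tuple R) R)
    (dT : measure_display) (T : measurableType dT) (Pr : probability T R)
    (X : nat -> {RV Pr >-> d.-tuple R})
    (X_indep : mutually_independent X)
    (X_law : forall i (A : set (d.-tuple R)), measurable A ->
       distribution Pr (X i) A = P A) :
  {ae Pr, forall w,
    ereal_sup [set `|robust_depth zd.2 zd.1 (empirical (fun i => X i w) n)
                     - robust_depth zd.2 zd.1 P|%E |
               zd in [set zd : d.-tuple R * R | 0 <= zd.2]]
      @[n --> \oo] --> 0%E}.
Proof.
apply: filterS (glivenko_cantelli P Pr X X_indep X_law) => w hw.
set D := fun n => ereal_sup _.
(* A supremum over an empty set would be [-oo]; the pair made of the origin and [delta = 0] gives a
   nonnegative member. *)
have D0 n : (0 <= D n)%E.
  set z : d.-tuple R := [tuple 0 | i < d].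
  apply: le_ereal_sup_tmp; eexists; last first.
    exact: (abse_ge0 (robust_depth 0 z (empirical (fun i => X i w) n)
                     - robust_depth 0 z P)%E).
  by exists (z, 0) => //=.
have De (e : R) : 0 < e -> \forall n \near \oo, (D n <= e%:E)%E.
  move=> e0; apply: filterS (hw e e0) => n hn.
  apply: ge_ereal_sup => _ [[z delta] /= d0 <-].
  by apply: robust_depth_dist => // a b; have [] := hn a b.
apply/fine_cvgP; split.
  apply: filterS (De 1 ltr01) => n Dn.
  by rewrite ge0_fin_numE// (le_lt_trans Dn) ?ltry.
apply/cvgrPdist_le => e e0; apply: filterS (De e e0) => n Dn.
have fD : D n \is a fin_num by rewrite ge0_fin_numE// (le_lt_trans Dn) ?ltry.
rewrite sub0r normrN /= ger0_norm ?fine_ge0//.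
by rewrite -lee_fin fineK.
Qed.
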